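(* For each $\bullet\in\{\mathrm{KNT},\mathrm{MJPO}\}$, there exist integers $k$ with $2\le k\le 22$ such that $$\dim_{\mathbb F_2}\mathcal E^{\mathfrak b,\bullet}_k\;<\;2^{k-2}-d_k .$$
   Context: Multi-indices. Let $\mathbf I=\bigcup_{r\ge 0}\{(k_1,\dots,k_r)\in\mathbb N^r : k_1\ge 2\}$ with $\mathbb N=\{1,2,\dots\}$, where $r=0$ gives only the empty index $\varnothing$. The weight of $(k_1,\dots,k_r)$ is $k_1+\dots+k_r$. Let $\mathbf I_k$ be the set of elements of $\mathbf I$ of weight $k$ (empty if $k<0$). Define sets of pairs of indices $$\widehat{\mathbf{PI}}^{\mathrm{MJPO}}_k=\Bigl(\bigcup_{i+j=k,\ i,j\ge0}\mathbf I_i\times\mathbf I_j\Bigr)\cup\bigl(\{(1)\}\times\mathbf I_{k-1}\bigr),$$ $$\widehat{\mathbf{PI}}^{\mathrm{KNT}}_k=\bigl(\{(3),(2,1)\}\times\mathbf I_{k-3}\bigr)\cup\bigl(\{(2)\}\times\mathbf I_{k-2}\bigr)\cup\bigl(\{(1)\}\times\mathbf I_{k-1}\bigr).$$ Products. Let $\mathfrak H=\mathbb Q\langle x,y\rangle$ (non-commutative polynomials), $z_k=x^{k-1}y$ for $k\ge1$, $z_{\mathbf k}=z_{k_1}\cdots z_{k_r}$, $z_\varnothing=1$. Let $\mathfrak H^1=\mathbb Q+\mathfrak H y=\mathbb Q\langle z_1,z_2,\dots\rangle$ and $\mathfrak H^0=\mathbb Q+x\mathfrak H y$, the $\mathbb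 Q$-span of $\{z_{\mathbf k}:\mathbf k\in\mathbf I\}$. The shuffle product $ш$ on $\mathfrak H$ is the $\mathbb Q$-bilinear product with $w\,ш\,1=1\,ш\,w=w$ and $au\,ш\,bv=a(u\,ш\,bv)+b(au\,ш\,v)$ for letters $a,b\in\{x,y\}$ and words $u,v,w$. The stuffle product $*$ on $\mathfrak H^1$ is the $\mathbb Q$-bilinear product with $w*1=1*w=w$ and $z_iu*z_jv=z_i(u*z_jv)+z_j(z_iu*v)+z_{i+j}(u*v)$ for $i,j\ge1$ and words $u,v,w$ in the $z_n$. Regularization. Every $w\in\mathfrak H^1$ can be written uniquely as $w=\sum_{i=0}^m w_i\,ш\,y^{ш i}$ with $w_i\in\mathfrak H^0$, where $y^{ш i}$ is the $i$-th shuffle power. Define $\mathrm{reg}_ш(w)=w_0\in\mathfrak H^0$. For a pair $(\mathbf k,\mathbf l)$ in one of the sets above put $\mathsf{ds}(\mathbf k,\mathbf l)=\mathrm{reg}_ш(z_{\mathbf k}*z_{\mathbf l})-\mathrm{reg}_ш(z_{\mathbf k}\,ш\,z_{\mathbf l})$. It is known that this is a $\mathbb Z$-linear combination of the $z_{\mathbf m}$, $\mathbf m\in\mathbf I_k$. Binary spaces. Let $\mathcal H^{\mathfrak b}_k$ be the $\mathbb F_2$-vector space with basis formal symbols $\eta^{\mathfrak b}(\mathbf k)$, $\mathbf k\in\mathbf I_k$. For a $\mathbb Z$-linear combination define $\mathrm{can}^{\mathfrak b}(\sum c_{\mathbf k}z_{\mathbf k})=\sum (c_{\mathbf k}\bmod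 2)\,\eta^{\mathfrak b}(\mathbf k)$. Let $\mathcal E^{\mathfrak b,\bullet}_k\subset\mathcal H^{\mathfrak b}_k$ be the $\mathbb F_2$-span of $\{\mathrm{can}^{\mathfrak b}(\mathsf{ds}(\mathbf k,\mathbf l)) : (\mathbf k,\mathbf l)\in\widehat{\mathbf{PI}}^{\bullet}_k\}$. The integers $d_k$ are defined by $d_0=1$, $d_1=0$, $d_2=1$ and $d_k=d_{k-2}+d_{k-3}$ for $k\ge3$. *)

(* Defs.v *)
From mathcomp Require Import all_boot all_order all_algebra.
From mathcomp Require Import finmap monalg.
From mathcomp Require Import classical_sets.

Set Implicit Arguments.
Unset Strict Implicit.
Unset Printing Implicit Defensive.

Import GRing.Theory.
Local Open Scope ring_scope.

Notation mindex := (seq nat).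

Definition in_I (k : mindex) : bool := all (leq 1) k && (1 < head 2 k)%N.

Definition weight (k : mindex) : nat := sumn k.

Fixpoint comps (r n : nat) : seq mindex :=
  if r is r'.+1 then [seq i :: c | i <- iota 1 n, c <- comps r' (n - i)%N]
  else if n == 0%N then [:: [::]] else [::].

(** The weight is an [int] so that the convention that there is no index of
    negative weight applies to weights such as [k - 3]. See [mem_Iwt]. *)
Definition Iwt (k : int) : seq mindex :=
  if k is Posz n then [seq c <- flatten [seq comps r n | r <- iota 0 n.+1] | in_I c]
  else [::].

Lemma mem_comps r n c :
  (c \in comps r n) = [&& size c == r, all (leq 1) c & sumn c == n].
Proof.
elim: r n c => [|r IHr] n c /=.
  by case: c => [|a c]; case: n.
apply/allpairsPdep/idP => [[i [c' [Hi Hc' ->]]]|].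
  move: Hc'; rewrite IHr /= => /and3P[/eqP-> -> /eqP->].
  by move: Hi; rewrite mem_iota add1n ltnS => /andP[-> Hi]; rewrite subnKC ?eqxx.
case: c => [|i c] //=; rewrite eqSS => /and3P[Hs /andP[Hi Hc] /eqP Hn].
exists i, c; rewrite mem_iota IHr Hs Hc Hi /= add1n ltnS -Hn.
by rewrite leq_addr addKn eqxx.
Qed.

Lemma mem_Iwt (k : int) (c : mindex) :
  (c \in Iwt k) = in_I c && ((weight c)%:Z == k).
Proof.
case: k => n; last by rewrite andbF.
rewrite /Iwt mem_filter; case Hc: (in_I c); rewrite ?andTb ?andFb //.
apply/idP/eqP => [/flattenP[s /mapP[r _ ->]]|[Hw]].
  by rewrite mem_comps => /and3P[_ _ /eqP<-].
apply/flattenP; exists (comps (size c) n); last first.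
  by rewrite mem_comps eqxx -Hw eqxx andbT; case/andP: Hc => ->.
apply/mapP; exists (size c) => //; rewrite mem_iota add0n ltnS -Hw /weight.
have : all (leq 1) c by case/andP: Hc.
elim: c {Hc Hw} => //= a c IHc /andP[Ha /IHc Hc].
by rewrite -add1n leq_add.
Qed.

Variant pair_family := KNT | MJPO.

Definition PIhat (b : pair_family) (k : nat) : seq (mindex * mindex) :=
  match b with
  | MJPO =>
      flatten [seq [seq (m, l) | m <- Iwt i%:Z, l <- Iwt (k%:Z - i%:Z)]
              | i <- iota 0 k.+1]
      ++ [seq ([:: 1%N], l) | l <- Iwt (k%:Z - 1)]
  | KNT =>
      [seq (m, l) | m <- [:: [:: 3%N]; [:: 2%N; 1%N]], l <- Iwt (k%:Z - 3)]
      ++ [seq ([:: 2%N], l) | l <- Iwt (k%:Z - 2)]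
      ++ [seq ([:: 1%N], l) | l <- Iwt (k%:Z - 1)]
  end.

(** Non-commutative polynomials over Q in letters from [A]. *)
Notation ncpoly A := {malg rat[{fmonom A}]}.

Definition monw (A : choiceType) (w : seq A) : ncpoly A := << FMonom w >>.

Definition linext (A : choiceType) (V : lmodType rat) (f : seq A -> V)
    (p : ncpoly A) : V :=
  \sum_(u <- msupp p) p@_u *: f u.

Definition bilinext (A : choiceType) (V : lmodType rat)
    (f : seq A -> seq A -> V) (p q : ncpoly A) : V :=
  \sum_(u <- msupp p) \sum_(v <- msupp q) (p@_u * q@_v) *: f u v.

(** The letters [x] and [y] are encoded by [false] and [true]. *)
Notation HH := (ncpoly bool).
Definition xH : HH := monw [:: false].
Definition yH : HH := monw [:: true].

Fixpoint shw (u v : seq bool) {struct u} : HH :=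
  if u is a :: u' then
    (fix shw_u (v : seq bool) : HH :=
       if v is b :: v' then
         monw [:: a] * shw u' v + monw [:: b] * shw_u v'
       else monw u) v
  else monw v.

Definition sh : HH -> HH -> HH := bilinext shw.

(** H^1 is presented as the free algebra on letters [z_n], the letter [n : nat]
    standing for [z_n]; the letter [0] never occurs in what follows. The
    embedding into H is [H1_to_H]. *)
Notation HH1 := (ncpoly nat).

Fixpoint stw (u v : seq nat) {struct u} : HH1 :=
  if u is i :: u' then
    (fix stw_u (v : seq nat) : HH1 :=
       if v is j :: v' then
         monw [:: i] * stw u' v + monw [:: j] * stw_u v'
         + monw [:: (i + j)%N] * stw u' v'
       else monw u) v
  else monw v.

Definition stuffle : HH1 -> HH1 -> HH1 := bilinext stw.

Definition word_of_index (k : mindex) : seq bool :=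
  flatten [seq rcons (nseq n.-1 false) true | n <- k].

Definition zH1 (k : mindex) : HH1 := monw k.
Definition zH (k : mindex) : HH := monw (word_of_index k).

Definition H1_to_H : HH1 -> HH := linext zH.

Definition in_H0 (w : HH) : Prop :=
  exists (c : rat) (h : HH), w = c%:A + xH * h * yH.

Definition ypow (i : nat) : HH := iter i (sh yH) 1.

Definition is_reg (w w0 : HH) : Prop :=
  exists (m : nat) (ws : nat -> HH),
    [/\ forall i, in_H0 (ws i),
        w = \sum_(i < m.+1) sh (ws i) (ypow i)
      & w0 = ws 0%N].

(** For [w] in H^1 there is exactly one [w0] with [is_reg w w0]. *)
Definition reg (w : HH) : HH := xget 0 [set w0 | is_reg w w0].

Definition ds (k l : mindex) : HH :=
  reg (H1_to_H (stuffle (zH1 k) (zH1 l))) - reg (sh (zH k) (zH l)).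

(** The function equal to 1 at [m] and 0 elsewhere is the basis symbol
    attached to [m]. *)
Notation Hbin k := {ffun seq_sub (Iwt (k : nat)%:Z) -> ('F_2)^o}.

(** Only applied to [p] with integer coefficients, for which [numq] returns the
    coefficient itself. *)
Definition canb (k : nat) (p : HH) : Hbin k :=
  [ffun m => (numq p@_(FMonom (word_of_index (ssval m))))%:~R].

Definition Ebin (b : pair_family) (k : nat) : {vspace Hbin k} :=
  <<[seq canb k (ds kl.1 kl.2) | kl <- PIhat b k]>>%VS.

Fixpoint dnum (k : nat) : nat :=
  match k with
  | 0 => 1%N
  | 1 => 0%N
  | 2 => 1%N
  | (k'.+1 as k1).+2 => (dnum k1 + dnum k')%N
  end.

(* Main.v *)
(** Both families already fail in weight 7, where [2 ^ 5 - d_7 = 29] but the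
    binary rank is at most 28.  Over F_2, four linearly independent linear forms
    (sums of coordinates) vanish on every generator, and this is a finite
    computation once [ds k l] is known explicitly.

    The regularization drops out of [ds k l]: the inadmissible words of the
    stuffle and shuffle products cancel, and regularizations are unique, so
    [ds k l] is the plain difference of the two products.  Uniqueness holds
    because deleting a leading [y] is a derivation for the shuffle product which
    kills H^0 and sends the i-th shuffle power of [y] to [i] times the previous
    one. *)

From HB Require Import structures.
Require Import Defs.
From mathcomp Require Import all_boot all_order all_algebra.
From mathcomp Require Import finmap monalg.
From mathcomp Require Import classical_sets.

Set Implicit Arguments.
Unset Strict Implicit.
Unset Printing Implicit Defensive.

Import GRing.Theory Num.Theory.
Local Open Scope ring_scope.

(** * Linear and bilinear extension from words, and sums of lists of words *)

Section LinearExtension.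

Variable A : choiceType.

Lemma linext_mon (V : lmodType rat) (f : seq A -> V) w : linext f (monw w) = f w.
Proof.
by rewrite /linext /monw msuppU oner_eq0 big_seq_fset1 mcoeffUU scale1r.
Qed.

Lemma linextEw (V : lmodType rat) (f : seq A -> V) (p : ncpoly A)
    (d : {fset {fmonom A}}) :
  (msupp p `<=` d)%fset -> linext f p = \sum_(u <- d) p@_u *: f u.
Proof.
move=> sd; rewrite /linext (big_fset_incl _ sd) // => u _ /mcoeff_outdom ->.
by rewrite scale0r.
Qed.

Lemma linext_is_linear (V : lmodType rat) (f : seq A -> V) : linear (linext f).
Proof.
move=> c p q; pose d := (msupp p `|` msupp q `|` msupp (c *: p + q))%fset.
have sp : (msupp p `<=` d)%fset by rewrite /d -fsetUA fsubsetUl.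
have sq : (msupp q `<=` d)%fset.
  by rewrite /d (fsetUC (msupp p)) -fsetUA fsubsetUl.
rewrite (linextEw _ sp) (linextEw _ sq) (@linextEw _ _ _ d) ?fsubsetUr //.
rewrite scaler_sumr -big_split; apply: eq_bigr => u _ /=.
by rewrite mcoeffD mcoeffZ scalerDl scalerA.
Qed.

HB.instance Definition _ (V : lmodType rat) (f : seq A -> V) :=
  GRing.isLinear.Build rat (ncpoly A) V *:%R (linext f) (linext_is_linear f).

(** Gives linearity of a bilinear extension in its second argument. *)
Lemma linext_linear_fun (V : lmodType rat) (c : rat) (f g h : seq A -> V) p :
  (forall u, h u = c *: f u + g u) -> linext h p = c *: linext f p + linext g p.
Proof.
move=> hE; rewrite /linext scaler_sumr -big_split; apply: eq_bigr => u _ /=.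
by rewrite hE scalerDr !scalerA mulrC.
Qed.

Lemma monw_span (p : ncpoly A) : p = linext (@monw A) p.
Proof.
rewrite {1}[p]monalgE /linext; apply: eq_bigr => u _.
apply/malgP => w; rewrite mcoeffZ !mcoeffU mulr_natr.
by case: u.
Qed.

(** Words span the algebra. The maps are plain functions with linearity as a hypothesis, so that ad
    hoc lambda terms can be compared. *)
Lemma linear_ext (V : lmodType rat) (f g : ncpoly A -> V) :
  linear f -> linear g -> (forall w, f (monw w) = g (monw w)) -> f =1 g.
Proof.
move=> lf lg fg.
pose F : {linear ncpoly A -> V} := HB.pack f (GRing.isLinear.Build _ _ _ _ f lf).
pose G : {linear ncpoly A -> V} := HB.pack g (GRing.isLinear.Build _ _ _ _ g lg).
suff: F =1 G by [].
move=> p; rewrite [p]monw_span /linext !linear_sum.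
by apply: eq_bigr => u _; rewrite !linearZ /= fg.
Qed.

Lemma bilinextE (V : lmodType rat) (f : seq A -> seq A -> V) p q :
  bilinext f p q = linext (fun u => linext (f u) q) p.
Proof.
rewrite /bilinext /linext; apply: eq_bigr => u _; rewrite scaler_sumr.
by apply: eq_bigr => v _; rewrite scalerA.
Qed.

Lemma bilinext_mon (V : lmodType rat) (f : seq A -> seq A -> V) u v :
  bilinext f (monw u) (monw v) = f u v.
Proof. by rewrite bilinextE !linext_mon. Qed.

Lemma monwM (u v : seq A) : monw u * monw v = monw (u ++ v) :> ncpoly A.
Proof.
rewrite /monw malgME !msuppU !oner_eq0 !big_seq_fset1 !mcoeffUU mulr1.
by congr (<< _ >>); apply: fmmulE.
Qed.

Lemma scale_malgU c a (k : {fmonom A}) :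
  c *: << a *g k >> = << c * a *g k >> :> ncpoly A.
Proof. by apply/malgP => w; rewrite mcoeffZ 2!mcoeffU mulrnAr. Qed.

(* [{malg _}] over a non-commutative monoid is only declared a left algebra. *)
Lemma ncpoly_scalerAr c (p q : ncpoly A) : p * (c *: q) = c *: (p * q).
Proof.
have sq : (msupp (c *: q) `<=` msupp q)%fset by apply: msuppZ_le.
rewrite (malgMEw (fsubset_refl _) sq) malgME !scaler_sumr.
apply: eq_bigr => u _; rewrite scaler_sumr; apply: eq_bigr => v _.
by rewrite mcoeffZ mulrCA scale_malgU.
Qed.

Lemma monw_nil : monw [::] = 1 :> ncpoly A.
Proof. by congr (<< _ >>); rewrite -fmoneE. Qed.

Definition wsum (L : seq (seq A)) : ncpoly A := \sum_(w <- L) monw w.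

Lemma wsum_cons (a : A) L : monw [:: a] * wsum L = wsum [seq a :: w | w <- L].
Proof.
by rewrite /wsum mulr_sumr big_map; apply: eq_bigr => w _; rewrite monwM.
Qed.

Lemma wsum_cat L1 L2 : wsum (L1 ++ L2) = wsum L1 + wsum L2.
Proof. by rewrite /wsum big_cat. Qed.

Lemma wsum1 w : wsum [:: w] = monw w.
Proof. by rewrite /wsum big_seq1. Qed.

Lemma perm_wsum L1 L2 : perm_eq L1 L2 -> wsum L1 = wsum L2.
Proof. exact: perm_big. Qed.

Lemma mcoeff_wsum L w : (wsum L)@_(FMonom w) = (count_mem w L)%:R.
Proof.
rewrite /wsum raddf_sum /= -sum1_count natr_sum [RHS]big_mkcond /=.
by apply: eq_bigr => v _; rewrite mcoeffU -val_eqE /=; case: (v == w).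
Qed.

End LinearExtension.


(** * Bilinearity, unit and commutativity of the shuffle product *)

Lemma sh_is_linear p : linear (sh p).
Proof.
move=> c q1 q2; rewrite /sh !bilinextE; apply: linext_linear_fun => u.
exact: linearP.
Qed.

HB.instance Definition _ p :=
  GRing.isLinear.Build rat HH HH *:%R (sh p) (sh_is_linear p).

(** Lets linearity of [sh] in its left argument be a registered instance too. *)
Definition shr q p := sh p q.

Lemma shr_is_linear q : linear (shr q).
Proof. by move=> c p1 p2; rewrite /shr /sh !bilinextE linearP. Qed.

HB.instance Definition _ q :=
  GRing.isLinear.Build rat HH HH *:%R (shr q) (shr_is_linear q).

Lemma sh0p q : sh 0 q = 0.
Proof. exact: (linear0 (shr q)). Qed.

Lemma shBl p1 p2 q : sh (p1 - p2) q = sh p1 q - sh p2 q.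
Proof. exact: (linearB (shr q)). Qed.

Lemma shZl c p q : sh (c *: p) q = c *: sh p q.
Proof. exact: (linearZ_LR (shr q)). Qed.

Lemma shPl c p1 p2 q : sh (c *: p1 + p2) q = c *: sh p1 q + sh p2 q.
Proof. exact: (linearP (shr q)). Qed.

Lemma sh_mon u v : sh (monw u) (monw v) = shw u v.
Proof. exact: bilinext_mon. Qed.

Lemma sh1p p : sh 1 p = p.
Proof. by rewrite -monw_nil /sh bilinextE linext_mon [RHS]monw_span. Qed.

Lemma shp1 p : sh p 1 = p.
Proof.
apply: (@linear_ext _ _ (shr 1) id) p => [||w]; [exact: shr_is_linear | by [] |].
by rewrite /shr -monw_nil sh_mon; case: w.
Qed.

Lemma shw_cons a u b v : shw (a :: u) (b :: v) =
  monw [:: a] * shw u (b :: v) + monw [:: b] * shw (a :: u) v.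
Proof. by []. Qed.

Lemma shwC u v : shw u v = shw v u.
Proof.
elim: u v => [|a u IHu] v; first by case: v.
elim: v => [|b v IHv]; first by [].
rewrite (shw_cons a) (shw_cons b) (IHu (b :: v)) IHv.
exact: addrC.
Qed.

(** * The derivation that deletes a leading [y] *)

Definition dely : HH -> HH :=
  linext (fun w => if w is true :: u then monw u else 0).

HB.instance Definition _ := GRing.Linear.on dely.

Lemma delyD p q : dely (p + q) = dely p + dely q.
Proof. exact: linearD. Qed.

Lemma dely0 : dely 0 = 0.
Proof. exact: linear0. Qed.

Lemma dely_sum I (r : seq I) (F : I -> HH) :
  dely (\sum_(i <- r) F i) = \sum_(i <- r) dely (F i).
Proof. exact: linear_sum. Qed.

Lemma dely_mon w : dely (monw w) = if w is true :: u then monw u else 0.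
Proof. exact: linext_mon. Qed.

Lemma dely1 : dely 1 = 0.
Proof. by rewrite -monw_nil dely_mon. Qed.

Lemma dely_letterM a p : dely (monw [:: a] * p) = if a then p else 0.
Proof.
apply: (@linear_ext _ _ (fun p => dely (monw [:: a] * p))
  (fun p => if a then p else 0)) p => [c p q|c p q|w].
- by rewrite mulrDr ncpoly_scalerAr linearP.
- by case: a; rewrite ?scaler0 ?addr0.
- by rewrite monwM dely_mon.
Qed.

Lemma dely_shw_cons a u b v : dely (shw (a :: u) (b :: v)) =
  (if a then shw u (b :: v) else 0) + (if b then shw (a :: u) v else 0).
Proof. by rewrite shw_cons delyD; congr (_ + _); apply: dely_letterM. Qed.

(** By bilinearity words suffice. The shuffle recursion puts each of the two first letters in front
    in turn, so deleting a leading [y] leaves exactly the two Leibniz terms. The empty word is the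
    unit and is killed by [dely]. *)
Lemma dely_sh p q : dely (sh p q) = sh (dely p) q + sh p (dely q).
Proof.
apply: (@linear_ext _ _ (fun p => dely (sh p q))
  (fun p => sh (dely p) q + sh p (dely q))) p => [c p r|c p r|u].
- by rewrite shPl linearP.
- by rewrite [dely (_ *: _ + _)]linearP /= 2!shPl scalerDr addrACA.
apply: (@linear_ext _ _ (fun q => dely (sh (monw u) q))
  (fun q => sh (dely (monw u)) q + sh (monw u) (dely q))) q => [c p r|c p r|v].
- by rewrite 2!linearP.
- by rewrite [dely (_ *: _ + _)]linearP /= 2!linearP /= scalerDr addrACA.
case: u v => [|a u] [|b v].
- by rewrite monw_nil sh1p dely1 sh0p add0r sh1p.
- by rewrite monw_nil 2!sh1p dely1 sh0p add0r.
- by rewrite monw_nil 2!shp1 dely1 linear0 addr0.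
rewrite sh_mon dely_shw_cons (dely_mon (a :: u)) (dely_mon (b :: v)).
congr (_ + _); first by case: a; rewrite ?sh_mon ?sh0p.
by case: b; rewrite ?sh_mon ?linear0.
Qed.

Lemma dely_ypow0 : dely (ypow 0) = 0.
Proof. exact: dely1. Qed.

Lemma ypowS i : ypow i.+1 = sh yH (ypow i).
Proof. by []. Qed.

(** As for the derivative of a power: [dely] sends [y] to 1, so each further factor [y] adds one
    copy of [ypow i] by the Leibniz rule. *)
Lemma dely_ypowS i : dely (ypow i.+1) = i.+1%:R *: ypow i.
Proof.
elim: i => [|i IHi]; rewrite ypowS dely_sh dely_mon monw_nil sh1p.
  by rewrite dely_ypow0 linear0 addr0 scale1r.
by rewrite IHi linearZ /= -ypowS -[i.+2]addn1 natrD addrC scalerDl scale1r.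
Qed.

(** * The subspace H^0 and uniqueness of the regularization *)

Lemma in_H0_lin c p q : in_H0 p -> in_H0 q -> in_H0 (c *: p + q).
Proof.
move=> [a [h ->]] [b [k ->]]; exists (c * a + b), (c *: h + k).
rewrite scalerDr scalerA mulrDr mulrDl ncpoly_scalerAr -scalerAl scalerDl.
exact: addrACA.
Qed.

Lemma in_H0_0 : in_H0 0.
Proof. by exists 0, 0; rewrite scale0r mulr0 mul0r addr0. Qed.

Lemma in_H0Z c p : in_H0 p -> in_H0 (c *: p).
Proof. by move=> Hp; rewrite -[_ *: _]addr0; apply/in_H0_lin/in_H0_0. Qed.

Lemma in_H0D p q : in_H0 p -> in_H0 q -> in_H0 (p + q).
Proof. by move=> Hp; rewrite -[p in p + q]scale1r; apply: in_H0_lin. Qed.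

Lemma in_H0B p q : in_H0 p -> in_H0 q -> in_H0 (p - q).
Proof. by move=> Hp Hq; rewrite addrC -scaleN1r; apply: in_H0_lin. Qed.

Lemma dely_H0 p : in_H0 p -> dely p = 0.
Proof.
move=> [c [h ->]]; rewrite linearP /= dely1 scaler0 add0r.
by rewrite -mulrA dely_letterM.
Qed.

(** Applying [dely], which kills the coefficients [d i], turns the relation into a shorter one with
    coefficients [i.+1%:R *: d i.+1]. By induction these vanish, and in characteristic 0 so do the
    [d i.+1]; the original relation then reads [d 0 = 0]. *)
Lemma sh_ypow_free n (d : nat -> HH) :
    (forall i, in_H0 (d i)) -> \sum_(i < n.+1) sh (d i) (ypow i) = 0 ->
  forall i, (i <= n)%N -> d i = 0.
Proof.
elim: n d => [|n IHn] d Hd sum0.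
  by move=> [|//] _; rewrite big_ord1 shp1 in sum0.
have dS i : (i <= n)%N -> d i.+1 = 0.
  move=> lein; apply: (scalerI (a := i.+1%:R)); first by rewrite pnatr_eq0.
  rewrite scaler0; move: i lein.
  apply: (IHn (fun i => i.+1%:R *: d i.+1)) => [i|]; first exact: in_H0Z.
  have delyE j : dely (sh (d j) (ypow j)) = sh (d j) (dely (ypow j)).
    by rewrite dely_sh dely_H0 // sh0p add0r.
  transitivity (dely (\sum_(j < n.+2) sh (d j) (ypow j))); last first.
    by rewrite sum0 dely0.
  rewrite dely_sum (eq_bigr _ (fun (j : 'I_n.+2) _ => delyE j)) [RHS]big_ord_recl.
  rewrite dely_ypow0 linear0 add0r; apply: eq_bigr => j _.
  rewrite lift0 dely_ypowS shZl.
  by rewrite [RHS]linearZ.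
have d0 : d 0%N = 0.
  rewrite big_ord_recl shp1 big1 ?addr0 // in sum0 => i _.
  by rewrite lift0 dS ?sh0p // -ltnS.
by move=> [|i] // /dS.
Qed.

Lemma is_reg_inj w w1 w2 : is_reg w w1 -> is_reg w w2 -> w1 = w2.
Proof.
move=> [m1 [f1 [H1 E1 ->]]] [m2 [f2 [H2 E2 ->]]].
(* The expansions may differ in length and their coefficients are arbitrary beyond it, so both are
   padded with 0 up to a common length. *)
pose trunc m (f : nat -> HH) i := if (i <= m)%N then f i else 0.
have truncH m f : (forall i, in_H0 (f i)) -> forall i, in_H0 (trunc m f i).
  by move=> Hf i; rewrite /trunc; case: ifP => // _; apply: in_H0_0.
have truncE m n f : (m <= n)%N ->
  \sum_(i < n.+1) sh (trunc m f i) (ypow i) = \sum_(i < m.+1) sh (f i) (ypow i).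
  move=> lemn; rewrite -ltnS in lemn.
  rewrite (big_ord_widen n.+1 (fun i => sh (f i) (ypow i)) lemn).
  rewrite [RHS]big_mkcond; apply: eq_bigr => i _; rewrite /trunc ltnS.
  by case: ifP => // _; rewrite sh0p.
apply/eqP; rewrite -subr_eq0; apply/eqP.
pose n := maxn m1 m2.
apply: (@sh_ypow_free n (fun i => trunc m1 f1 i - trunc m2 f2 i)) 0%N _ => //.
  by move=> i; apply: in_H0B; apply: truncH.
transitivity (\sum_(i < n.+1) sh (trunc m1 f1 i) (ypow i)
  - \sum_(i < n.+1) sh (trunc m2 f2 i) (ypow i)); last first.
  rewrite (truncE _ _ _ (leq_maxl m1 m2)) (truncE _ _ _ (leq_maxr m1 m2)).
  by rewrite -E1 -E2 subrr.
by rewrite -sumrB; apply: eq_bigr => i _; rewrite shBl.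
Qed.

Lemma regE w w0 : is_reg w w0 -> reg w = w0.
Proof. by move=> Hw; apply: xget_unique => // w1 /is_reg_inj; apply. Qed.

Lemma is_regD_H0 q q0 h : is_reg q q0 -> in_H0 h -> is_reg (h + q) (h + q0).
Proof.
move=> [m [f [Hf -> ->]]] Hh; exists m, (fun i => if i is 0 then h + f 0%N else f i).
split; [by case=> [|i]; [apply: in_H0D | apply: Hf] | | by []].
by rewrite 2!big_ord_recl 2!shp1 addrA.
Qed.

(** Adding [p - q] to the constant coefficient of an expansion of [q] gives one of [p], so the two
    regularizations differ by [p - q]. *)
Lemma regB_H0 p q q0 : is_reg q q0 -> in_H0 (p - q) -> reg p - reg q = p - q.
Proof.
move=> Hq /(is_regD_H0 Hq); rewrite subrK => /regE ->.
by rewrite (regE Hq) addrK.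
Qed.

Lemma is_reg_H0 w : in_H0 w -> is_reg w w.
Proof. by move=> Hw; exists 0%N, (fun=> w); rewrite big_ord1 shp1. Qed.

Lemma is_reg_sh_y w : in_H0 w -> is_reg (sh w yH) 0.
Proof.
move=> Hw; exists 1%N, (fun i => if i is 1 then w else 0).
split; [by case=> [|[|i]] //; apply: in_H0_0 | | by []].
have -> : \sum_(i < 2) sh (if val i is 1 then w else 0) (ypow i)
  = sh 0 1 + sh w (sh yH 1) by rewrite big_ord_recl big_ord1.
by rewrite sh0p add0r shp1.
Qed.

(** * Products as lists of words, and [ds] without regularization *)

(** Executable form of [shw], as [stuffles] is of [stw]: repetitions in the list carry the
    coefficients. *)
Fixpoint shuffles (u v : seq bool) {struct u} : seq (seq bool) :=
  if u is a :: u' then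
    (fix shuffles_u (v : seq bool) : seq (seq bool) :=
       if v is b :: v' then
         [seq a :: w | w <- shuffles u' v] ++ [seq b :: w | w <- shuffles_u v']
       else [:: u]) v
  else [:: v].

Fixpoint stuffles (u v : seq nat) {struct u} : seq (seq nat) :=
  if u is i :: u' then
    (fix stuffles_u (v : seq nat) : seq (seq nat) :=
       if v is j :: v' then
         [seq i :: w | w <- stuffles u' v] ++ [seq j :: w | w <- stuffles_u v']
         ++ [seq (i + j)%N :: w | w <- stuffles u' v']
       else [:: u]) v
  else [:: v].

Lemma shwE u v : shw u v = wsum (shuffles u v).
Proof.
elim: u v => [|a u IHu] v; first by rewrite wsum1.
elim: v => [|b v IHv]; first by rewrite wsum1.
by rewrite shw_cons IHu IHv (wsum_cons a) (wsum_cons b) -wsum_cat.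
Qed.

Lemma stw_cons i u j v : stw (i :: u) (j :: v) =
  monw [:: i] * stw u (j :: v) + monw [:: j] * stw (i :: u) v
  + monw [:: (i + j)%N] * stw u v.
Proof. by []. Qed.

Lemma stwE u v : stw u v = wsum (stuffles u v).
Proof.
elim: u v => [|i u IHu] v; first by rewrite wsum1.
elim: v => [|j v IHv]; first by rewrite wsum1.
rewrite stw_cons (IHu (j :: v)) IHv (IHu v).
by rewrite (wsum_cons i) (wsum_cons j) (wsum_cons (i + j)%N) -addrA -2!wsum_cat.
Qed.

Lemma H1_to_H_wsum L : H1_to_H (wsum L) = wsum (map word_of_index L).
Proof.
rewrite /H1_to_H /wsum linear_sum big_map; apply: eq_bigr => w _.
exact: linext_mon.
Qed.

Definition admissible (w : seq bool) :=
  (w == [::]) || ~~ head true w && last false w.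

Lemma in_H0_monw w : admissible w -> in_H0 (monw w).
Proof.
case: w => [|a w] /=.
  by exists 1, 0; rewrite mulr0 mul0r addr0 scale1r monw_nil.
case: a; first by [].
case/lastP: w => [//|w a]; rewrite /admissible /= last_rcons => ->.
exists 0, (monw w); rewrite scale0r add0r (monwM [:: false]) monwM.
by rewrite cats1.
Qed.

Lemma in_H0_wsum L : all admissible L -> in_H0 (wsum L).
Proof.
elim: L => [|w L IHL] /=; first by rewrite /wsum big_nil => _; apply: in_H0_0.
case/andP=> Hw HL; rewrite /wsum big_cons.
by apply: in_H0D; [apply: in_H0_monw | apply: IHL].
Qed.

(** The inadmissible words cancel in the difference, leaving sums of words of H^0. *)
Lemma in_H0_wsumB L M :
    perm_eq [seq w <- L | ~~ admissible w] [seq w <- M | ~~ admissible w] ->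
  in_H0 (wsum L - wsum M).
Proof.
have split K : wsum K = wsum [seq w <- K | admissible w]
                      + wsum [seq w <- K | ~~ admissible w].
  by rewrite -wsum_cat; apply/perm_wsum; rewrite perm_sym perm_filterC.
move=> /perm_wsum eqLM; rewrite (split L) (etrans (split M) (addrC _ _)) eqLM.
rewrite addrKA.
by apply: in_H0B; apply: in_H0_wsum; apply: filter_all.
Qed.

Definition st_words (k l : mindex) := map word_of_index (stuffles k l).
Definition sh_words (k l : mindex) := shuffles (word_of_index k) (word_of_index l).

(* Words starting with [y] occur only for the pairs [([:: 1], l)]; there
   [sh y z_l = sh z_l y] has regularization 0. *)
Definition ds_regular (k l : mindex) :=
  perm_eq [seq w <- st_words k l | ~~ admissible w]
          [seq w <- sh_words k l | ~~ admissible w]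
  && (all admissible (sh_words k l)
      || (k == [:: 1%N]) && admissible (word_of_index l)).

(** [ds_regular] supplies what [regB_H0] asks for: a difference in H^0, and a regularization of the
    shuffle product, namely the product itself or 0. *)
Lemma dsE k l : ds_regular k l -> ds k l = wsum (st_words k l) - wsum (sh_words k l).
Proof.
case/andP=> eq_nonadm sh_adm.
have st_wsum : H1_to_H (stuffle (zH1 k) (zH1 l)) = wsum (st_words k l).
  by rewrite /stuffle /zH1 bilinext_mon stwE H1_to_H_wsum.
have sh_wsum : sh (zH k) (zH l) = wsum (sh_words k l) by rewrite sh_mon shwE.
have [q0 reg_q0] : exists q0, is_reg (sh (zH k) (zH l)) q0.
  case/orP: sh_adm => [/in_H0_wsum adm|/andP[/eqP-> /in_H0_monw adm]].
    by exists (sh (zH k) (zH l)); apply: is_reg_H0; rewrite sh_wsum.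
  by exists 0; rewrite sh_mon shwC -sh_mon; apply: is_reg_sh_y.
rewrite /ds -sh_wsum -st_wsum; apply: regB_H0 reg_q0 _.
by rewrite st_wsum sh_wsum; apply: in_H0_wsumB.
Qed.

(** Modulo 2 the minus sign becomes a plus, so only the number of occurrences in the concatenated
    lists matters. *)
Lemma canb_dsE k l n m : ds_regular k l ->
  canb n (ds k l) m =
  (count_mem (word_of_index (ssval m)) (st_words k l ++ sh_words k l))%:R.
Proof.
move=> /dsE ->; rewrite ffunE mcoeffB 2!mcoeff_wsum count_cat.
set a := count_mem _ _; set b := count_mem _ _.
(* The coefficient is exhibited as an integer, which [numq] returns unchanged. *)
rewrite -[_ - _]/(a%:Z%:~R - b%:Z%:~R) -intrB numq_int intrB natrD.
by rewrite [- _]oppr_pchar2 // pchar_Fp.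
Qed.

(** * Bounding a dimension by independent annihilating forms *)

(** The [r] forms define a map to [F^r] whose kernel contains [E]. It is onto because the dual
    coordinates [p i] lift the standard basis, so rank-nullity applies. *)
Lemma dim_annihilated (F : fieldType) (I : finType) (r : nat)
    (S : 'I_r -> pred I) (E : {vspace {ffun I -> F^o}}) :
    (forall v, v \in E -> forall j, \sum_(m | S j m) v m = 0) ->
    (forall i, exists m, forall j, S j m = (i == j)) ->
  (\dim E + r <= #|I|)%N.
Proof.
move=> SE /fin_all_exists[p Sp].
pose f (v : {ffun I -> F^o}) : {ffun 'I_r -> F^o} :=
  [ffun j => \sum_(m | S j m) v m].
have f_linear : linear f.
  move=> c u v; apply/ffunP => j; rewrite !ffunE scaler_sumr -big_split.
  by apply: eq_bigr => m _; rewrite !ffunE.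
pose L : {linear _ -> _} := HB.pack f (GRing.isLinear.Build _ _ _ _ f f_linear).
have dim_ffun (J : finType) : \dim {: {ffun J -> F^o}} = #|J|.
  by rewrite dimvf /dim /= muln1.
have imL : limg (linfun L) = fullv.
  apply/eqP; rewrite eqEsubv subvf; apply/subvP => w _.
  pose u : {ffun I -> F^o} := [ffun m => \sum_i w i * (m == p i)%:R].
  suff <- : linfun L u = w by apply/memv_img/memvf.
  apply/ffunP => j; rewrite lfunE /= ffunE.
  rewrite (eq_bigr _ (fun m _ => ffunE _ m)) exchange_big /=.
  have diag i : \sum_(m | S j m) w i * (m == p i)%:R = w i * (i == j)%:R.
    rewrite -mulr_sumr; congr (_ * _); rewrite -Sp big_mkcond (bigD1 (p i)) //=.
    rewrite eqxx big1 ?addr0; first by case: (S j (p i)).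
    by move=> m /negPf->; case: ifP.
  rewrite (eq_bigr _ (fun i _ => diag i)) (bigD1 j) //= eqxx mulr1 big1 ?addr0 //.
  by move=> i /negPf->; rewrite mulr0.
have := limg_ker_dim (linfun L) fullv.
rewrite imL capfv !dim_ffun card_ord => <-; rewrite leq_add2r.
apply: dimvS; apply/subvP => v Ev; rewrite memv_ker lfunE /=.
by apply/eqP/ffunP => j; rewrite !ffunE SE.
Qed.

(** * The finite computation in weight 7 *)

(** Passes from sums over coordinates to sums over a list, which can be evaluated. *)
Lemma big_seq_sub (T : choiceType) (s : seq T) (P : pred T) (c : T -> nat) :
  uniq s ->
  (\sum_(m : seq_sub s | P (ssval m)) c (ssval m) = \sum_(m <- s | P m) c m)%N.
Proof.
move=> us; rewrite -[in RHS](val_seq_sub_enum us) big_map.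
apply: perm_big; apply: uniq_perm; rewrite ?index_enum_uniq ?undup_uniq // => m.
by rewrite mem_index_enum mem_seq_sub_enum.
Qed.

(* The supports of four independent solutions of the linear system over F_2
   whose rows are the generators in weight 7, found by Gaussian elimination. *)
Definition annihilators : seq (seq mindex) :=
  [:: [:: [:: 2; 1; 1; 1; 1; 1]; [:: 2; 1; 1; 1; 2]; [:: 2; 1; 1; 2; 1];
          [:: 2; 1; 2; 1; 1]; [:: 2; 2; 1; 1; 1]; [:: 2; 2; 1; 2];
          [:: 2; 2; 2; 1]; [:: 2; 3; 2]; [:: 2; 4; 1]; [:: 2; 5];
          [:: 3; 1; 1; 1; 1]; [:: 3; 1; 1; 2]; [:: 3; 1; 2; 1]; [:: 3; 2; 2];
          [:: 3; 3; 1]; [:: 3; 4]; [:: 4; 3]; [:: 5; 2]; [:: 6; 1]; [:: 7]];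
      [:: [:: 2; 1; 2; 2]; [:: 2; 2; 2; 1]; [:: 2; 2; 3]; [:: 2; 4; 1];
          [:: 3; 1; 1; 2]; [:: 3; 2; 1; 1]; [:: 3; 2; 2]; [:: 4; 2; 1]];
      [:: [:: 2; 1; 1; 3]; [:: 2; 1; 4]; [:: 2; 2; 1; 2]; [:: 2; 2; 2; 1];
          [:: 2; 3; 1; 1]; [:: 2; 3; 2]; [:: 3; 1; 2; 1]; [:: 3; 2; 1; 1];
          [:: 3; 2; 2]; [:: 3; 3; 1]; [:: 4; 1; 2]; [:: 4; 2; 1]];
      [:: [:: 2; 1; 3; 1]; [:: 2; 2; 1; 2]; [:: 2; 3; 2]; [:: 2; 4; 1];
          [:: 3; 1; 1; 2]; [:: 3; 1; 2; 1]; [:: 3; 1; 3]; [:: 3; 2; 1; 1];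
          [:: 3; 3; 1]; [:: 4; 1; 1; 1]; [:: 4; 2; 1]; [:: 5; 1; 1]]]%N.

(** Vanishing over F_2 of the form with support [S] on the generator of [(k, l)], phrased as a
    parity of natural numbers so that it computes. *)
Definition annihilated (S : seq mindex) (k l : mindex) :=
  ~~ odd (sumn [seq count_mem (word_of_index m) (st_words k l ++ sh_words k l)
               | m <- Iwt 7%:Z & m \in S]).

Lemma PIhat7_annihilated b :
  all (fun kl => ds_regular kl.1 kl.2
                 && all (fun S => annihilated S kl.1 kl.2) annihilators)
      (PIhat b 7).
Proof. by case: b; vm_compute. Qed.

(** The kernel of a form is a subspace, so generators suffice; on these [canb_dsE] reduces the claim
    to the parity already computed. *)
Lemma Ebin7_annihilated b S v : S \in annihilators -> v \in Ebin b 7 ->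
  \sum_(m | ssval m \in S) v m = 0.
Proof.
move=> annS; have uI : uniq (Iwt 7%:Z) by vm_compute.
pose f (v : Hbin 7) : ('F_2)^o := \sum_(m | ssval m \in S) v m.
have f_linear : linear f.
  move=> c u w; rewrite /f scaler_sumr -big_split.
  by apply: eq_bigr => m _; rewrite !ffunE.
pose L : {linear _ -> _} := HB.pack f (GRing.isLinear.Build _ _ _ _ f f_linear).
have EL : (Ebin b 7 <= lker (linfun L))%VS.
  apply/span_subvP => _ /mapP[[k l] kl_in ->]; rewrite memv_ker lfunE /=.
  have /andP[reg_kl ann_kl] := allP (PIhat7_annihilated b) _ kl_in.
  have := allP ann_kl _ annS.
  rewrite /annihilated sumnE big_map big_filter -(big_seq_sub _ _ uI) => even_sum.
  rewrite /f (eq_bigr _ (fun m _ => canb_dsE m reg_kl)) -natr_sum.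
  by rewrite -(dvdn_pcharf (pchar_Fp (isT : prime 2))) dvdn2.
by move=> /(subvP EL); rewrite memv_ker lfunE => /eqP.
Qed.

Theorem mainTheorem4 (b : pair_family) :
  exists k : nat,
    (2 <= k <= 22)%N /\ (\dim (Ebin b k) < 2 ^ (k - 2) - dnum k)%N.
Proof.
exists 7%N; split=> //.
(* There are 32 indices of weight 7 and [dnum 7] is 3, so four independent forms leave at most 28,
   below 29; three would not be enough. *)
suff : (\dim (Ebin b 7) + 4 <= #|{: seq_sub (Iwt 7%:Z)}|)%N.
  rewrite card_seq_sub; last by vm_compute.
  by rewrite (_ : size _ = 28 + 4)%N ?leq_add2r //; vm_compute.
apply: (dim_annihilated (S := fun j m => ssval m \in nth [::] annihilators j)).
  by move=> v Ev j; apply: (Ebin7_annihilated _ Ev); apply: mem_nth.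
have ord_iota (i : 'I_4) : (i : nat) \in iota 0 4 by rewrite mem_iota ltn_ord.
(* Coordinates dual to the four forms, which prove their independence. *)
pose p := [:: [:: 7]; [:: 2; 2; 3]; [:: 4; 1; 2]; [:: 5; 1; 1]]%N.
have pP : all (fun i => (nth [::] p i \in Iwt 7%:Z)
    && all (fun j => (nth [::] p i \in nth [::] annihilators j) == (i == j))
           (iota 0 4)) (iota 0 4) by vm_compute.
move=> i; have /andP[p_i /allP p_iP] := allP pP i (ord_iota i).
exists (SeqSub p_i) => j; apply/eqP/p_iP/ord_iota.
Qed.
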